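(* For every integer $d\ge 1$ there exist $d$ matrices $A_1,\ldots,A_d\in \mathbf{H}_d(\mathbb{R})$ such that $\mathcal{A}=(A_j)_{j=1}^d$ has the almost everywhere phase retrieval property in $\mathbb{R}^d$.
   Context: $\mathbf{H}_d(\mathbb{R})$ is the set of real symmetric $d\times d$ matrices. A tuple $\mathcal{A}=(A_j)_{j=1}^N\in \mathbf{H}_d(\mathbb{R})^N$ has the almost everywhere phase retrieval property in $\mathbb{R}^d$ if for Lebesgue-almost every $x\in\mathbb{R}^d$ the following holds: whenever $y\in\mathbb{R}^d$ satisfies $y^{T}A_jy=x^{T}A_jx$ for all $1\le j\le N$, then $y=x$ or $y=-x$. *)

(* Defs.v *)
From HB Require Import structures.
From mathcomp Require Import all_boot all_order all_algebra.
From mathcomp Require Import sesquilinear.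
From mathcomp Require Import all_classical all_reals all_analysis.
Set Implicit Arguments.
Unset Strict Implicit.
Unset Printing Implicit Defensive.
Import Order.TTheory GRing.Theory Num.Theory.
Local Open Scope classical_set_scope.
Local Open Scope ring_scope.

Definition cons_tuple (T : Type) (n : nat) (p : T * n.-tuple T) : n.+1.-tuple T :=
  [tuple of p.1 :: p.2].

(* Lebesgue measure on the Borel sets of R^n: the n-fold product of the
   one-dimensional Lebesgue measure (the point mass when n = 0). *)
Fixpoint lebesgue_tuple (R : realType) (n : nat) :
    set (n.-tuple (measurableTypeR R)) -> \bar R :=
  if n is m.+1 then
    pushforward (lebesgue_measure \x lebesgue_tuple (R := R) (n := m))%E
      (@cons_tuple (measurableTypeR R) m)
  else \d_ [tuple].

Section lebesgue_tuple_measure.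
Context (R : realType).
Let T := measurableTypeR R.

Lemma measurable_cons_tuple n :
  measurable_fun [set: T * n.-tuple T] (@cons_tuple T n).
Proof. by apply: measurable_cons. Qed.

Lemma cons_tuple_preimage_box n (A : 'I_n.+1 -> set T) :
  @cons_tuple T n @^-1` [set x | forall i, A i (tnth x i)] =
  A ord0 `*` [set x : n.-tuple T | forall i, A (lift ord0 i) (tnth x i)].
Proof.
apply/seteqP; split => -[a x] /=.
  move=> Aax; split => /= [|i]; first exact: (Aax ord0).
  by have := Aax (lift ord0 i); rewrite tnthS /cons_tuple.
move=> [/= Aa Ax] i; have [->//|i0] := eqVneq i ord0.
have [j ->] : exists j, i = lift ord0 j.
  by case: (unliftP ord0 i) i0 => [j ->|->]; [exists j|rewrite eqxx].
by rewrite tnthS.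
Qed.

Section cons.
Context (n : nat) (m : {sigma_finite_measure set (n.-tuple T) -> \bar R}).

Let mu : set (n.+1.-tuple T) -> \bar R :=
  pushforward (lebesgue_measure \x m)%E (@cons_tuple T n).

Let mu0 : mu set0 = 0%E.
Proof. by rewrite /mu /pushforward preimage_set0 measure0. Qed.

Let mu_ge0 A : (0 <= mu A)%E.
Proof. exact: (measure_ge0 (lebesgue_measure \x m)%E). Qed.

Let mu_sigma_additive : semi_sigma_additive mu.
Proof.
have mcons := @measurable_cons_tuple n.
have mpre (A : set (n.+1.-tuple T)) :
    measurable A -> measurable (@cons_tuple T n @^-1` A).
  by move=> mA; rewrite -[X in measurable X]setTI; exact: mcons.
move=> F mF tF mUF; rewrite /mu /pushforward preimage_bigcup.
apply: (@measure_semi_sigma_additive _ _ _ (lebesgue_measure \x m)%E).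
- by move=> i; exact: mpre.
- apply/trivIsetP => /= i j _ _ ij; rewrite -preimage_setI.
  by move/trivIsetP : tF => /(_ _ _ _ _ ij) ->//; rewrite preimage_set0.
- by rewrite -preimage_bigcup; exact: mpre.
Qed.

HB.instance Definition _ :=
  isMeasure.Build _ _ _ mu mu0 mu_ge0 mu_sigma_additive.

Let mu_sigma_finite : sigma_finite setT mu.
Proof.
have /sigma_finiteP[F [TF ndF Foo]] := sigma_finiteT (@lebesgue_measure R).
have /sigma_finiteP[G [TG ndG Goo]] := sigma_finiteT m.
pose g (x : n.+1.-tuple T) : T * n.-tuple T := (thead x, [tuple of behead x]).
have Kg : cancel (@cons_tuple T n) g by move=> [a x]; congr pair; exact/val_inj.
have mg : measurable_fun [set: n.+1.-tuple T] g.
  apply/measurable_fun_pair; first exact: measurable_tnth.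
  exact: measurable_behead.
exists (fun k => g @^-1` (F k `*` G k)).
  apply/esym/seteqP; split => // x _.
  have [i _ Fi] : (\bigcup_i F i) (thead x) by rewrite -TF.
  have [j _ Gj] : (\bigcup_j G j) [tuple of behead x] by rewrite -TG.
  exists (maxn i j) => //; split => /=.
    by move: Fi; exact/subsetPset/ndF/leq_maxl.
  by move: Gj; exact/subsetPset/ndG/leq_maxr.
move=> k; have [mF Fkoo] := Foo k; have [mG Gkoo] := Goo k; split.
  by rewrite -[X in measurable X]setTI; apply: mg => //; exact: measurableX.
rewrite /mu /pushforward -comp_preimage (_ : g \o _ = id); last first.
  by apply/funext => x /=; rewrite Kg.
by rewrite preimage_id product_measure1E// lte_mul_pinfty// ge0_fin_numE.
Qed.

HB.instance Definition _ := Measure_isSigmaFinite.Build _ _ _ mu mu_sigma_finite.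

Definition lebesgue_tuple_cons : {sigma_finite_measure set _ -> \bar R} := mu.

End cons.

Lemma lebesgue_tuple_subproof n :
  {m : {sigma_finite_measure set (n.-tuple T) -> \bar R} |
    lebesgue_tuple (R := R) (n := n) = m}.
Proof.
elim: n => [|n [m mE]]; first by exists (\d_ [tuple]).
by exists (lebesgue_tuple_cons m); rewrite /= mE.
Qed.

Section instances.
Variable n : nat.
Local Notation leb := (@lebesgue_tuple R n).

Let leb0 : leb set0 = 0%E.
Proof. by have [m ->] := lebesgue_tuple_subproof n; exact: measure0. Qed.

Let leb_ge0 A : (0 <= leb A)%E.
Proof. by have [m ->] := lebesgue_tuple_subproof n; exact: measure_ge0. Qed.

Let leb_sigma_additive : semi_sigma_additive leb.
Proof.
have [m ->] := lebesgue_tuple_subproof n.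
exact: measure_semi_sigma_additive.
Qed.

HB.instance Definition _ :=
  isMeasure.Build _ _ _ leb leb0 leb_ge0 leb_sigma_additive.

Let leb_sigma_finite : sigma_finite setT leb.
Proof. by have [m ->] := lebesgue_tuple_subproof n; exact: sigma_finiteT. Qed.

HB.instance Definition _ :=
  Measure_isSigmaFinite.Build _ _ _ leb leb_sigma_finite.

End instances.

Lemma measurable_tuple_box n (A : 'I_n -> set T) :
  (forall i, measurable (A i)) ->
  measurable [set x : n.-tuple T | forall i, A i (tnth x i)].
Proof.
move=> mA.
rewrite (_ : [set _ | _] = \bigcap_(i in [set: 'I_n]) (@tnth n T ^~ i @^-1` A i)).
  apply: fin_bigcap_measurable => // i _.
  by rewrite -[X in measurable X]setTI; exact: measurable_tnth.
by apply/seteqP; split => x /= Ax i; [move=> _|]; exact: Ax.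
Qed.

Lemma lebesgue_tuple_box n (A : 'I_n -> set T) :
  (forall i, measurable (A i)) ->
  lebesgue_tuple [set x | forall i, A i (tnth x i)] =
  (\prod_(i < n) lebesgue_measure (A i))%E.
Proof.
elim: n A => [|n IHn] A mA.
  by rewrite big_ord0 /= diracE mem_set//= => -[].
rewrite big_ord_recl /= /pushforward cons_tuple_preimage_box.
rewrite (product_measure1E _ (@lebesgue_tuple R n)) //.
  by congr (_ * _)%E; apply: (IHn (fun i => A (lift ord0 i))) => i; exact: mA.
by apply: (@measurable_tuple_box n (fun i => A (lift ord0 i))) => i; exact: mA.
Qed.

End lebesgue_tuple_measure.

Definition vec_of_tuple (R : realType) (d : nat) (x : d.-tuple R) : 'cV[R]_d :=
  \col_i tnth x i.

Definition ae_phase_retrieval (R : realType) (d N : nat)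
    (A : 'I_N -> 'M[R]_d) : Prop :=
  {ae @lebesgue_tuple R d, forall t : d.-tuple (measurableTypeR R),
    let x : 'cV[R]_d := vec_of_tuple t in
    forall y : 'cV[R]_d,
      (forall j, y^T *m A j *m y = x^T *m A j *m x) -> y = x \/ y = - x}.

(* Main.v *)
Require Import Defs.
From mathcomp Require Import all_boot all_order all_algebra.
From mathcomp Require Import sesquilinear.
From mathcomp Require Import all_classical all_reals all_analysis.
Import GRing.Theory Num.Theory.
Local Open Scope classical_set_scope.
Local Open Scope ring_scope.

(** The quadratic forms [2 x_0 x_j], for [0 <= j < d], suffice.  The first one
    determines [x_0] up to sign; when [x_0 != 0], dividing the others by [x_0]
    shows that all remaining coordinates are determined by [x_0], and that they
    change sign with it ([quad_arrow_inj]).  The exceptional vectors lie on the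
    hyperplane [x_0 = 0], a box with one side of length zero, which is
    Lebesgue-negligible ([lebesgue_tuple_hyperplane]). *)

Definition arrow_mx (R : pzRingType) (n : nat) (j : 'I_n.+1) : 'M[R]_n.+1 :=
  delta_mx ord0 j + delta_mx j ord0.

Lemma arrow_mx_sym (R : pzRingType) (n : nat) (j : 'I_n.+1) :
  (arrow_mx R n j)^T = arrow_mx R n j.
Proof. by rewrite /arrow_mx linearD /= !trmx_delta addrC. Qed.

Lemma quad_delta (R : comPzRingType) (n : nat) (i j : 'I_n) (x : 'cV[R]_n) :
  (x^T *m delta_mx i j *m x) ord0 ord0 = x i ord0 * x j ord0.
Proof.
rewrite -(mul_delta_mx (ord0 : 'I_1)) mulmxA -colE -mulmxA -rowE.
by rewrite mxE big_ord1 !mxE.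
Qed.

Lemma quad_arrow (R : comPzRingType) (n : nat) (j : 'I_n.+1)
    (x : 'cV[R]_n.+1) :
  (x^T *m arrow_mx R n j *m x) ord0 ord0 = (x ord0 ord0 * x j ord0) *+ 2.
Proof.
by rewrite mulmxDr mulmxDl mxE !quad_delta [X in _ + X]mulrC mulr2n.
Qed.

(** The form of index [0] gives [y_0 = x_0] or [y_0 = - x_0]; since [x_0] can be
    cancelled, the form of index [j] transfers this sign to the coordinate
    [j]. *)
Lemma quad_arrow_inj (R : numDomainType) (n : nat) (x y : 'cV[R]_n.+1) :
    x ord0 ord0 != 0 ->
    (forall j, y^T *m arrow_mx R n j *m y = x^T *m arrow_mx R n j *m x) ->
  y = x \/ y = - x.
Proof.
move=> x0 yx.
have {}yx j : y ord0 ord0 * y j ord0 = x ord0 ord0 * x j ord0.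
  have := congr1 (fun M : 'M[R]_1 => M ord0 ord0) (yx j).
  by rewrite !quad_arrow => /eqP; rewrite eqrMn2r // => /eqP.
have /eqP := yx ord0; rewrite -!expr2 eqf_sqr => /orP[] /eqP y0; [left|right];
  apply/colP => j; rewrite ?mxE; apply: (mulfI x0).
  by rewrite -yx y0.
by rewrite mulrN -yx y0 mulNr opprK.
Qed.

Lemma lebesgue_tuple_hyperplane (R : realType) (n : nat) :
  (@lebesgue_tuple R n.+1).-negligible
    [set t : n.+1.-tuple (measurableTypeR R) | tnth t ord0 = 0].
Proof.
pose A (i : 'I_n.+1) : set (measurableTypeR R) :=
  if i == ord0 then [set 0] else setT.
have mA i : measurable (A i) by rewrite /A; case: ifP.
exists [set t | forall i, A i (tnth t i)]; split.
- exact: measurable_tuple_box.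
- by rewrite lebesgue_tuple_box// big_ord_recl /A eqxx lebesgue_measure_set1 mul0e.
- by move=> t /= t0 i; rewrite /A; case: eqP => [->|].
Qed.

Theorem theorem1p3 (R : realType) (d : nat) (hd : (1 <= d)%N) :
  exists A : 'I_d -> 'M[R]_d,
    (forall j : 'I_d, A j \is symmetricmx) /\ ae_phase_retrieval A.
Proof.
case: d hd => // n _; exists (arrow_mx R n); split.
  by move=> j; apply/is_hermitianmxP; rewrite expr0 scale1r map_mx_id // arrow_mx_sym.
apply: negligibleS (lebesgue_tuple_hyperplane R n) => t /=.
apply: contra_notP => /eqP t0 y; apply: quad_arrow_inj.
by rewrite mxE.
Qed.
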